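(* Let $n\ge 2$. The number of narcissistic preference profiles $(\succ_1,\succ_2,\dots,\succ_n)$ for the voter set $\mathcal{V}=\{1,2,\dots,n\}$ that are single-crossing with respect to the linear order $1\triangleright 2\triangleright\cdots\triangleright n$ is $2^{\binom{n-1}{2}}$.
   Context: Let $\mathcal{V}=\{1,2,\dots,n\}$ be a set of voters, which is also the set of alternatives. A preference order $\succ$ on $\mathcal{V}$ is a strict linear order on $\mathcal{V}$; $a\succ b$ means $a$ is preferred to $b$. A preference profile for $\mathcal{V}$ is an $n$-tuple $(\succ_1,\dots,\succ_n)$ of preference orders on $\mathcal{V}$, where $\succ_i$ is the preference order of voter $i$. A profile is narcissistic if for every voter $i\in\mathcal{V}$ the most preferred alternative in $\succ_i$ is $i$ itself. Given a (strict) linear order $\triangleright$ on $\mathcal{V}$, a profile is single-crossing with respect to $\triangleright$ if for every two distinct alternatives $a,b\in\mathcal{V}$ and every three voters $i,j,k\in\mathcal{V}$ with $i\triangleright j\triangleright k$: if $a\succ_i b$ and $a\succ_k b$, then $a\succ_j b$. Profiles are counted as $n$-tuples (distinct tuples are distinct profiles). The convention $\binom{1}{2}=0$ is used. *)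

(* Defs.v *)
From HB Require Import structures.
From mathcomp Require Import all_boot.

Set Implicit Arguments.
Unset Strict Implicit.
Unset Printing Implicit Defensive.

(* The pair (a, b) belongs to R when a is before b (a preferred to b). *)
Definition strict_linear (n : nat) (R : {set 'I_n * 'I_n}) : bool :=
  [&& [forall a, (a, a) \notin R],
      [forall a, forall b, forall c,
         ((a, b) \in R) && ((b, c) \in R) ==> ((a, c) \in R)]
    & [forall a, forall b, (a != b) ==> ((a, b) \in R) || ((b, a) \in R)]].

Lemma strict_linearP (n : nat) (R : {set 'I_n * 'I_n}) :
  let lt : rel 'I_n := fun a b => (a, b) \in R in
  reflect [/\ irreflexive lt, transitive lt
            & forall a b, a != b -> lt a b || lt b a]
          (strict_linear R).
Proof.
move=> lt; apply: (iffP and3P) => -[irrR trR totR]; split.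
- by move=> a; apply/negbTE/(forallP irrR).
- move=> b a c ab bc.
  by have /forallP/(_ b)/forallP/(_ c)/implyP := forallP trR a; apply; apply/andP.
- by move=> a b; apply/implyP; have /forallP := forallP totR a; apply.
- by apply/forallP => a; have:= irrR a; rewrite /lt => ->.
- apply/forallP => a; apply/forallP => b; apply/forallP => c.
  by apply/implyP => /andP[]; apply: trR.
- by apply/forallP => a; apply/forallP => b; apply/implyP; apply: totR.
Qed.

Record linorder (n : nat) : predArgType := LinOrder {
  linorder_graph :> {set 'I_n * 'I_n};
  linorder_strict_linear : strict_linear linorder_graph
}.

HB.instance Definition _ n := [isSub for @linorder_graph n].
HB.instance Definition _ n := [Finite of linorder n by <:].

Definition before (n : nat) (R : linorder n) : rel 'I_n :=
  fun a b => (a, b) \in linorder_graph R.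

Fact nat_order_subproof (n : nat) :
  strict_linear [set p : 'I_n * 'I_n | p.1 < p.2].
Proof.
apply/strict_linearP; split.
- by move=> a; rewrite inE ltnn.
- by move=> b a c; rewrite !inE; apply: ltn_trans.
- by move=> a b; rewrite !inE -neq_ltn.
Qed.

Definition nat_order (n : nat) : linorder n := LinOrder (nat_order_subproof n).

(* Voters and alternatives 1, ..., n are represented by 0, ..., n - 1 in 'I_n;
   P i is the preference order of voter i. *)
Notation profile n := {ffun 'I_n -> linorder n}.

Definition narcissistic (n : nat) (P : profile n) : bool :=
  [forall i, forall a, (a != i) ==> before (P i) i a].

Definition single_crossing (n : nat) (T : linorder n) (P : profile n) : bool :=
  [forall a, forall b, (a != b) ==>
    [forall i, forall j, forall k, before T i j && before T j k ==>
      (before (P i) a b && before (P k) a b ==> before (P j) a b)]].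

(* Main.v *)
(* In a narcissistic single-crossing profile every pair a < b of alternatives is
   swapped exactly once along the voters, after some voter t(a,b) with
   a <= t(a,b) < b, and transitivity of all the preferences amounts to
   t(a,b) <= t(a,c) <= t(b,c) for a < b < c.  The diagonals b - a = 1, 2, ...
   of t are therefore the rows of a Gelfand-Tsetlin pattern whose top row is
   fixed; adding the column index to each row makes the interlacing half-strict,
   and the top row becomes 0, 2, ..., 2(m-1), where m = n - 1.
   The number of patterns with top row l is det 'C(l_j, i): summing over the
   interlacing rows r in l_j <= r_j < l_{j+1} telescopes each row of the smaller
   determinant, by multilinearity.  Finally (1 + X)^(2j) = (1 + (2X + X^2))^j
   factors the matrix 'C(2j, i) into a unitriangular one and a triangular one
   with diagonal 2^k. *)
Require Import Defs.
From mathcomp Require Import all_boot all_fingroup all_algebra zify.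

Set Implicit Arguments.
Unset Strict Implicit.
Unset Printing Implicit Defensive.

Import GRing.Theory Num.Theory.

(** * Sequences interlacing a given row *)

Fixpoint interlacings (x : nat) (l : seq nat) : seq (seq nat) :=
  if l is y :: l' then [seq z :: r | z <- index_iota x y, r <- interlacings y l']
  else [:: [::]].

Lemma mem_interlacings x l r :
  reflect (size r = size l /\ forall j, j < size l ->
             nth 0 (x :: l) j <= nth 0 r j < nth 0 l j)
          (r \in interlacings x l).
Proof.
elim: l x r => [|y l IHl] x r /=.
  rewrite inE; apply: (iffP eqP) => [-> //|[/size0nil -> //]].
apply: (iffP allpairsPdep) => [[z [r' [zxy /IHl[szr' r'P] ->]]]|].
  split=> [|[|j] ltj] /=; first by rewrite szr'.
    by rewrite mem_index_iota in zxy.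
  exact: r'P.
case: r => [|z r] [//] /= [szr rP]; exists z, r; split=> //.
  by rewrite mem_index_iota; apply: (rP 0).
by apply/IHl; split=> // j ltj; apply: (rP j.+1).
Qed.

Lemma interlacings_uniq x l : uniq (interlacings x l).
Proof.
elim: l x => //= y l IHl x; apply: allpairs_uniq_dep => [|//|].
  exact: iota_uniq.
by move=> [z r] [z' r'] _ _ /= [-> ->].
Qed.

(** * Determinants of binomial coefficients *)

Section BinomialDeterminants.
Local Open Scope ring_scope.

(** The entries range over their intervals independently, so this is distributivity of products over
    sums. *)
Lemma sum_interlacings_prod (R : comPzRingType) x (l : seq nat)
    (F : 'I_(size l) -> nat -> R) :
  \sum_(r <- interlacings x l) \prod_(j < size l) F j (nth 0%N r j) =
  \prod_(j < size l) \sum_(nth 0%N (x :: l) j <= z < nth 0%N l j) F j z.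
Proof.
elim: l x F => [|y l IHl] x F /=; first by rewrite big_seq1 !big_ord0.
rewrite big_allpairs_dep big_ord_recl /= mulr_suml; apply: eq_bigr => z _.
under eq_bigr => r _ do rewrite big_ord_recl /=.
by rewrite -big_distrr /= (IHl y (fun j => F (lift ord0 j))).
Qed.

Definition binom_mx m (l : seq nat) : 'M[int]_m :=
  \matrix_(j, i) 'C(nth 0%N l j, i)%:R.

(** Multilinearity in the rows, by the Leibniz formula: the previous lemma applies to each
    permutation. *)
Lemma sum_interlacings_det x (l : seq nat) :
  \sum_(r <- interlacings x l) \det (binom_mx (size l) r) =
  \det (\matrix_(j < size l, i < size l)
    \sum_(nth 0%N (x :: l) j <= z < nth 0%N l j) ('C(z, i)%:R : int)).
Proof.
rewrite /determinant exchange_big /=; apply: eq_bigr => s _.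
rewrite -big_distrr /=; congr (_ * _).
rewrite [RHS](eq_bigr (fun j : 'I_(size l) =>
  \sum_(nth 0%N (x :: l) j <= z < nth 0%N l j) ('C(z, s j)%:R : int))).
  rewrite -(@sum_interlacings_prod _ x l (fun j z => 'C(z, s j)%:R)).
  by apply: eq_bigr => r _; apply: eq_bigr => j _; rewrite mxE.
by move=> j _; rewrite mxE.
Qed.

Lemma sum_bin (a b i : nat) : (a <= b)%N ->
  \sum_(a <= z < b) ('C(z, i)%:R : int) = 'C(b, i.+1)%:R - 'C(a, i.+1)%:R.
Proof.
move=> leab; rewrite -(telescope_sumr (fun z => 'C(z, i.+1)%:R : int) leab).
by apply: eq_bigr => z _; rewrite binS natrD addrAC subrr add0r.
Qed.

Lemma det_binom_mx_cons x (l : seq nat) : sorted leq (x :: l) ->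
  \det (binom_mx (size l).+1 (x :: l)) =
  \sum_(r <- interlacings x l) \det (binom_mx (size l) r).
Proof.
move=> sorted_l; rewrite sum_interlacings_det.
(* Left multiplication by L replaces each row but the first by its difference
   with the preceding one, so that only the first row meets column 0. *)
pose L : 'M[int]_((size l).+1) := \matrix_(j, k)
  ((j == k)%:R - (j == k.+1 :> nat)%:R).
have detL : \det L = 1.
  rewrite det_trig; last first.
    apply/is_trig_mxP => j k ltjk; rewrite mxE.
    by rewrite -val_eqE /= !ltn_eqF // ltnW.
  by rewrite big1 // => j _; rewrite mxE eqxx ltn_eqF.
have <- : \det (L *m binom_mx _ (x :: l)) = \det (binom_mx (size l).+1 (x :: l)).
  by rewrite det_mulmx detL mul1r.
have LE j i : (L *m binom_mx _ (x :: l)) j i =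
   'C(nth 0%N (x :: l) j, i)%:R -
   (if j is Ordinal j'.+1 _ then 'C(nth 0%N (x :: l) j', i)%:R else 0).
  rewrite mxE.
  under eq_bigr => k _ do rewrite !mxE mulrBl.
  rewrite sumrB (bigD1 j) //= eqxx mul1r big1 ?addr0; last first.
    by move=> k neq; rewrite eq_sym (negbTE neq) mul0r.
  congr (_ - _); case: j => [[|j] ltj] /=.
    by rewrite big1 // => k _; rewrite mul0r.
  rewrite (bigD1 (Ordinal (ltnW ltj))) //= eqxx mul1r big1 ?addr0 //.
  by move=> k; rewrite -val_eqE eqSS eq_sym /= => /negbTE->; rewrite mul0r.
rewrite (expand_det_col _ ord0) big_ord_recl big1 ?addr0; last first.
  by move=> j _; rewrite LE /= !bin0 subrr mul0r.
rewrite LE subr0 bin0 mul1r /cofactor expr0 mul1r; congr (\det _).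
(* The remaining minor holds differences of consecutive rows in the columns [i.+1], which are
   telescoped interval sums; sortedness gives the bound required by [sum_bin]. *)
apply/matrixP => j i; rewrite 2!mxE LE !mxE lift0 /= sum_bin //.
by have /(sortedP 0%N)/(_ j) := sorted_l; apply; rewrite /= ltnS.
Qed.

Lemma det_binom_mx_even m :
  \det (binom_mx m [seq (2 * j)%N | j <- iota 0 m]) = (2 ^ 'C(m, 2))%:R.
Proof.
pose p : {poly int} := 'X * ('X + 2%:R).
pose L : 'M[int]_m := \matrix_(j, k) 'C(j, k)%:R.
pose U : 'M[int]_m := \matrix_(k, i) (p ^+ k)`_i.
(* X^k divides p^k with cofactor (X + 2)^k, so [U] is upper triangular with diagonal entries 2^k. *)
have UE k i : (p ^+ k)`_i = if (i < k)%N then 0 else (('X + 2%:R) ^+ k)`_(i - k).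
  by rewrite exprMn coefXnM.
have -> : binom_mx m [seq (2 * j)%N | j <- iota 0 m] = L *m U.
  apply/matrixP => j i; rewrite !mxE (nth_map 0%N) ?size_iota // nth_iota // add0n.
  under eq_bigr => k _ do rewrite !mxE.
  have coef_bin N : ('C(N, i)%:R : int) = (('X + 1) ^+ N : {poly int})`_i.
    rewrite exprD1n coef_sum.
    under eq_bigr => k _ do rewrite coefMn coefXn.
    have [ltNi|leiN] := ltnP N i.
      rewrite bin_small // big1 // => k _.
      by rewrite gtn_eqF ?mul0rn // (leq_ltn_trans _ ltNi) // -ltnS.
    rewrite -ltnS in leiN; rewrite (bigD1 (Ordinal leiN)) //= eqxx big1 ?addr0 //.
    by move=> k; rewrite -val_eqE eq_sym /= => /negbTE->; rewrite mul0rn.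
  rewrite coef_bin exprM.
  have -> : ('X + 1) ^+ 2 = p + 1 :> {poly int}.
    by rewrite /p sqrrD1 expr2 mulrDr mulr_natr.
  (* The binomial sum stops at k = j; 'C(j, k) = 0 beyond, so it extends to all k < m. *)
  rewrite exprD1n coef_sum (big_ord_widen m (fun k => (p ^+ k *+ 'C(j, k))`_i)) //.
  rewrite big_mkcond /=; apply: eq_bigr => k _; rewrite ltnS coefMn.
  have [_|ltjk] := leqP k j; first by rewrite mulr_natl.
  by rewrite bin_small ?mul0r.
rewrite det_mulmx det_trig; last first.
  by apply/is_trig_mxP => j k ltjk; rewrite mxE bin_small.
rewrite big1 ?mul1r => [|j _]; last by rewrite mxE binn.
rewrite -det_tr det_trig; last first.
  by apply/is_trig_mxP => j k ltjk; rewrite !mxE UE ltjk.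
rewrite -bin2_sum expn_sum big_mkord natr_prod; apply: eq_bigr => k _.
by rewrite !mxE UE ltnn subnn -horner_coef0 horner_exp !hornerE natrX.
Qed.

End BinomialDeterminants.

(** * Half-strict Gelfand-Tsetlin patterns *)

(** The top row [l] is not stored. When [size l = m], the stored rows have sizes m - 1, ..., 0, so
    the last one is empty. *)
Fixpoint gt_patterns m (l : seq nat) : seq (seq (seq nat)) :=
  if m is m'.+1 then
    [seq r :: p | r <- interlacings (head 0 l) (behead l), p <- gt_patterns m' r]
  else [:: [::]].

Lemma gt_patterns_uniq m l : uniq (gt_patterns m l).
Proof.
elim: m l => //= m IHm l; apply: allpairs_uniq_dep => [|//|].
  exact: interlacings_uniq.
by move=> [r p] [r' p'] _ _ /= [-> ->].
Qed.

Definition entry (p : seq (seq nat)) d j := nth 0 (nth [::] p d) j.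

Lemma mem_gt_patterns m l p : size l = m ->
  reflect [/\ size p = m,
              forall d, d < m -> size (nth [::] p d) = m - d.+1
            & forall d j, d + j.+1 < m ->
                entry (l :: p) d j <= entry (l :: p) d.+1 j
                  < entry (l :: p) d j.+1]
          (p \in gt_patterns m l).
Proof.
elim: m l p => [|m IHm] l p szl /=.
  rewrite inE; apply: (iffP eqP) => [->|[/size0nil -> //]].
  by split=> // d; rewrite ltn0.
case: l szl => // x l [szl] /=.
apply: (iffP allpairsPdep) => [[r [q [/mem_interlacings[szr r_l] q_r ->]]]|].
  have szrm : size r = m by rewrite szr.
  have /(IHm _ _ szrm)[szq szqs q_int] := q_r.
  split=> [|[|d] ltd|[|d] j ltdj] /=; first by rewrite szq.
  - by rewrite subn1.
  - by rewrite subSS szqs.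
  - by rewrite /entry /=; apply: r_l; rewrite szl.
  - exact: q_int.
case: p => [|r q] [] //= [szq] szqs q_int.
have szr : size r = m by rewrite (szqs 0) // subn1.
exists r, q; split=> //.
  apply/mem_interlacings; rewrite szr szl; split=> // j ltj.
  exact: (q_int 0 j).
apply/(IHm _ _ szr); split=> // [d ltd|d j ltdj].
  by rewrite (szqs d.+1) ?subSS.
exact: (q_int d.+1 j).
Qed.

Lemma size_gt_patterns m l : size l = m -> sorted leq l ->
  ((size (gt_patterns m l))%:R = \det (binom_mx m l))%R.
Proof.
elim: m l => [|m IHm] [|x l] //= => [_ _|[szl] sorted_l].
  by rewrite det_mx00.
rewrite size_allpairs_dep; subst m; rewrite det_binom_mx_cons // sumnE big_map natr_sum.
rewrite big_seq [RHS]big_seq; apply: eq_bigr => r /mem_interlacings[szr r_int].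
(* The row [r] is again sorted: r_j < l_j <= r_(j+1). *)
rewrite IHm //; apply/(sortedP 0) => j ltj.
have ltj' : j < size l by rewrite -szr ltnW.
have /andP[_ ltl] := r_int j ltj'; rewrite szr in ltj.
by have /andP[lel _] := r_int j.+1 ltj; apply: leq_trans (ltnW ltl) lel.
Qed.

Lemma size_gt_patterns_even m :
  size (gt_patterns m [seq 2 * j | j <- iota 0 m]) = 2 ^ 'C(m, 2).
Proof.
apply/eqP; rewrite -(eqr_nat int) size_gt_patterns ?det_binom_mx_even //.
  by rewrite size_map size_iota.
apply/(sortedP 0) => j; rewrite size_map size_iota => ltj.
by rewrite !(nth_map 0) ?size_iota ?nth_iota; lia.
Qed.

(** * Threshold arrays as patterns *)

Definition threshold_array n (t : nat -> nat -> nat) :=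
  (forall a b, a < b < n -> a <= t a b < b) /\
  (forall a b c, a < b < c -> c < n -> t a b <= t a c <= t b c).

(* Row d holds the diagonal b - a = d + 2; the diagonal b - a = 1, on which
   t(a, a + 1) = a is forced, is the top row and is left out. *)
Definition pattern_of m (t : nat -> nat -> nat) :=
  mkseq (fun d => mkseq (fun j => t j (j + d.+2) + j) (m - d.+1)) m.

(** Putting the top row back shifts the indices: row [d] is now the diagonal b - a = d + 1. For d =
    0 the forced value t(j, j + 1) = j gives 2j. *)
Lemma entry_pattern_of m t d j : threshold_array m.+1 t -> d + j < m ->
  entry ([seq 2 * j | j <- iota 0 m] :: pattern_of m t) d j
  = t j (j + d.+1) + j.
Proof.
move=> [t_bd _] ltdj; case: d ltdj => [|d] ltdj.
  rewrite /entry /= (nth_map 0) ?size_iota // nth_iota // addn1.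
  by have := t_bd j j.+1; lia.
by rewrite /entry /= !nth_mkseq //; lia.
Qed.

Lemma pattern_of_mem m t : threshold_array m.+1 t ->
  pattern_of m t \in gt_patterns m [seq 2 * j | j <- iota 0 m].
Proof.
move=> t_arr; apply/mem_gt_patterns; first by rewrite size_map size_iota.
split=> [|d ltd|d j ltdj]; first by rewrite size_mkseq.
  by rewrite nth_mkseq // size_mkseq.
rewrite !entry_pattern_of //; try lia.
have [_ t_mono] := t_arr.
have := t_mono j (j + d.+1) (j + d.+2); have := t_mono j j.+1 (j + d.+2).
rewrite (_ : j.+1 + d.+1 = j + d.+2); lia.
Qed.

Lemma pattern_of_inj m t u : pattern_of m t = pattern_of m u ->
  threshold_array m.+1 t -> threshold_array m.+1 u ->
  forall a b, a < b < m.+1 -> t a b = u a b.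
Proof.
move=> eq_tu t_arr u_arr a b /andP[ltab ltbm].
have ltm : b - a.+1 + a < m by lia.
have := entry_pattern_of t_arr ltm; rewrite eq_tu entry_pattern_of //.
by rewrite (_ : a + (b - a.+1).+1 = b) => [/addIn|]; last lia.
Qed.

Lemma mem_gt_patterns_pattern_of m p :
  p \in gt_patterns m [seq 2 * j | j <- iota 0 m] ->
  exists2 t, threshold_array m.+1 t & pattern_of m t = p.
Proof.
set l := map _ _; have szl : size l = m by rewrite size_map size_iota.
move=> /(mem_gt_patterns _ szl)[szp szps p_int].
pose y := entry (l :: p).
have y0 j : j < m -> y 0 j = 2 * j.
  by move=> ltj; rewrite /y /entry /= (nth_map 0) ?size_iota ?nth_iota.
have y_le d e j : d + e + j < m -> y d j <= y (d + e) j.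
  elim: e => [|e IHe] lt_m; first by rewrite addn0.
  rewrite addnS; apply: leq_trans (IHe _) _; first lia.
  by have := p_int (d + e) j; rewrite -/y; lia.
have y_lt d e j : d + e + j < m -> y (d + e) j + e <= y d (j + e).
  elim: e j => [|e IHe] j lt_m; first by rewrite !addn0.
  have := p_int (d + e) j; have := IHe j.+1; rewrite -/y.
  rewrite !(addnS, addSn); lia.
(* The subtraction does not truncate: columns increase downwards from 2a. *)
pose t a b := y (b - a.+1) a - a.
have tE a b : a < b < m.+1 -> t a b + a = y (b - a.+1) a.
  move=> ltab; rewrite subnK //.
  have := y_le 0 (b - a.+1) a; rewrite add0n y0; lia.
exists t.
  split=> [a b ltab|a b c ltabc ltcm].
    have := tE _ _ ltab; have := y_le 0 (b - a.+1) a.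
    have := y_lt 0 (b - a.+1) a; rewrite add0n !y0; lia.
  have := tE a b; have := tE a c; have := tE b c.
  (* The b - a strict steps of [y_lt] absorb the change of column shift from a to b. *)
  have := y_le (b - a.+1) (c - b) a; have := y_lt (c - b.+1) (b - a) a.
  rewrite (_ : b - a.+1 + (c - b) = c - a.+1); last lia.
  rewrite (_ : c - b.+1 + (b - a) = c - a.+1); last lia.
  rewrite (_ : a + (b - a) = b); lia.
apply: (@eq_from_nth _ [::]); rewrite size_mkseq // => d ltd.
rewrite nth_mkseq //; apply: (@eq_from_nth _ 0); rewrite size_mkseq ?szps // => j ltj.
by rewrite nth_mkseq // tE; last lia; rewrite (_ : j + d.+2 - j.+1 = d.+1); last lia.
Qed.

(** * Thresholds of a profile *)

Lemma before_irr n (R : linorder n) : irreflexive (before R).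
Proof. by have [] := strict_linearP (linorder_graph R) (linorder_strict_linear R). Qed.

Lemma before_trans n (R : linorder n) : transitive (before R).
Proof. by have [] := strict_linearP _ (linorder_strict_linear R). Qed.

Lemma beforeC n (R : linorder n) a b : a != b -> before R b a = ~~ before R a b.
Proof.
move=> neqab; have [_ _ /(_ a b neqab)] := strict_linearP _ (linorder_strict_linear R).
rewrite -/(before R a b) -/(before R b a).
case ab: (before R a b) => //= _; apply/negbTE/negP => /(before_trans ab).
by rewrite before_irr.
Qed.

Section Thresholds.
Variable n : nat.
Implicit Types (P : profile n) (a b c i j k : 'I_n).

Lemma narcissisticP P :
  reflect (forall i a, a != i -> before (P i) i a) (narcissistic P).
Proof.
apply: (iffP forallP) => [narP i a|narP i].
  by have /forallP/(_ a)/implyP := narP i.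
by apply/forallP => a; apply/implyP/narP.
Qed.

Lemma single_crossingP P :
  reflect (forall a b i j k, a != b -> i < j < k ->
             before (P i) a b -> before (P k) a b -> before (P j) a b)
          (single_crossing (nat_order n) P).
Proof.
apply: (iffP forallP) => [scP a b i j k ab ijk iab kab|scP a].
  have /forallP/(_ b)/implyP/(_ ab)/forallP/(_ i) := scP a.
  move=> /forallP/(_ j)/forallP/(_ k)/implyP; rewrite /before !inE /=.
  by move=> /(_ ijk)/implyP; apply; apply/andP.
apply/forallP => b; apply/implyP => ab; do 3!apply/forallP => ?.
apply/implyP; rewrite /before !inE /= => ijk.
by apply/implyP => /andP[]; apply: scP ijk.
Qed.

Definition threshold P a b := \max_(i | before (P i) a b) (i : nat).

Section Valid.
Variable P : profile n.
Hypotheses (narP : narcissistic P) (scP : single_crossing (nat_order n) P).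

(* If j prefers a to b but i < j does not, then one of the voters a and b,
   who rank themselves first, makes the pair swap back. *)
Lemma before_downward a b i j : a < b -> i < j ->
  before (P j) a b -> before (P i) a b.
Proof.
move=> ltab ltij jab; apply: contraLR jab.
have neqab : a != b by rewrite -val_eqE ltn_eqF.
have bba : before (P b) b a := narcissisticP _ narP _ _ neqab.
have aab : before (P a) a b by apply: narcissisticP narP _ _ _; rewrite eq_sym.
rewrite -!beforeC // => iba.
have [ltjb|ltbj|/val_inj-> //] := ltngtP j b.
  by apply: (single_crossingP _ scP) iba bba; rewrite 1?eq_sym ?ltij.
rewrite beforeC //; apply: contraL bba => jab; rewrite -beforeC 1?eq_sym //.
by apply: (single_crossingP _ scP) aab jab; rewrite ?ltab.
Qed.

(** By [before_downward] the voters preferring [a] to [b] form an initial segment; it contains voter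
    [a], so its maximum is attained. *)
Lemma beforeE a b i : a < b -> before (P i) a b = (i <= threshold P a b).
Proof.
move=> ltab; apply/idP/idP => [iab|]; first exact: leq_bigmax_cond.
have aab : before (P a) a b.
  by apply: narcissisticP narP _ _ _; rewrite -val_eqE gtn_eqF.
have [|j jab] := @eq_bigmax_cond _ [pred i | before (P i) a b] (fun i => i : nat).
  by apply/card_gt0P; exists a.
rewrite /threshold => ->; rewrite leq_eqVlt => /predU1P[/val_inj-> //|ltij].
exact: before_downward ltab ltij jab.
Qed.

Lemma threshold_bounds a b : a < b -> a <= threshold P a b < b.
Proof.
move=> ltab; have neqab : a != b by rewrite -val_eqE ltn_eqF.
rewrite ltnNge -!beforeE // -beforeC // !(narcissisticP _ narP) //.
by rewrite eq_sym.
Qed.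

Lemma threshold_le a b c : a < b < c ->
  threshold P a b <= threshold P a c <= threshold P b c.
Proof.
case/andP=> ltab ltbc; have ltac := ltn_trans ltab ltbc.
have /andP[_ tabb] := threshold_bounds ltab.
have /andP[btbc tbcc] := threshold_bounds ltbc.
have /andP[_ tacc] := threshold_bounds ltac.
apply/andP; split.
  (* Voter t(a,b) prefers a to b, and b to c because t(a,b) < b <= t(b,c). *)
  pose i := Ordinal (ltn_trans tabb (ltn_ord b)).
  rewrite -[threshold P a b]/(i : nat) -beforeE //.
  apply: (@before_trans _ _ b); rewrite beforeE //.
  exact: leq_trans (ltnW tabb) btbc.
rewrite leqNgt; apply/negP => ltt.
(* If t(b,c) < t(a,c), voter t(a,c) prefers c to b and b to a, yet a to c. *)
pose i := Ordinal (ltn_trans tacc (ltn_ord c)).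
have : before (P i) a c by rewrite beforeE.
apply/negP; rewrite -beforeC -?val_eqE ?ltn_eqF //.
apply: (@before_trans _ _ b); rewrite beforeC -?val_eqE ?ltn_eqF // beforeE //.
  by rewrite -ltnNge.
by rewrite -ltnNge (leq_trans tabb) // (leq_trans btbc) // ltnW.
Qed.

End Valid.
End Thresholds.

(** * Profiles versus threshold arrays *)

Definition threshold_nat m (P : profile m.+1) a b :=
  threshold P (inord a) (inord b).

Lemma threshold_nat_array m (P : profile m.+1) :
  narcissistic P -> single_crossing (nat_order m.+1) P ->
  threshold_array m.+1 (threshold_nat P).
Proof.
move=> narP scP; split=> [a b ltab|a b c ltabc ltcm].
  have := threshold_bounds narP scP (a := inord a) (b := inord b).
  rewrite /threshold_nat !inordK; lia.
have := threshold_le narP scP (a := inord a) (b := inord b) (c := inord c).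
rewrite /threshold_nat !inordK; lia.
Qed.

Lemma threshold_nat_inj m (P Q : profile m.+1) :
  narcissistic P -> single_crossing (nat_order m.+1) P ->
  narcissistic Q -> single_crossing (nat_order m.+1) Q ->
  (forall a b, a < b < m.+1 -> threshold_nat P a b = threshold_nat Q a b) ->
  P = Q.
Proof.
move=> narP scP narQ scQ eqPQ; apply/ffunP => i; apply/val_inj/setP => -[a b].
rewrite -[LHS]/(before (P i) a b) -[RHS]/(before (Q i) a b).
have lt_eq (c d : 'I_m.+1) : c < d -> before (P i) c d = before (Q i) c d.
  move=> ltcd; rewrite !beforeE //; have := eqPQ c d.
  by rewrite /threshold_nat !inord_val => ->; rewrite ?ltcd /=.
have [/lt_eq//|ltba|/val_inj->] := ltngtP a b; last by rewrite !before_irr.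
by rewrite !(@beforeC _ _ b a) ?lt_eq // -val_eqE ltn_eqF.
Qed.

(** The only order for voter [i] compatible with [beforeE]. *)
Definition order_at n (t : nat -> nat -> nat) (i : nat) : {set 'I_n * 'I_n} :=
  [set p : 'I_n * 'I_n | if p.1 < p.2 then i <= t p.1 p.2 else (p.2 < p.1) && (t p.2 p.1 < i)].

(** A cycle on x < y < z would need t(x,z) < i <= t(x,y) or t(y,z) < i <= t(x,z); monotonicity of
    [t] excludes both. *)
Lemma order_at_strict_linear n t i :
  threshold_array n t -> strict_linear (order_at n t i).
Proof.
case=> t_bd t_le; apply/strict_linearP; split.
- by move=> a; rewrite inE /= ltnn.
- move=> b a c; rewrite !inE /=.
  have := ltn_ord a; have := ltn_ord b; have := ltn_ord c.
  have [ltab|ltba|//] := ltngtP a b.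
    have [ltbc|ltcb|] := ltngtP b c; last by [].
      by rewrite (ltn_trans ltab ltbc); have := t_le a b c; lia.
    have [ltac|ltca|/val_inj eqac] := ltngtP a c.
    + have := t_le a c b; lia.
    + have := t_le c a b; lia.
    + by rewrite eqac; lia.
  have [ltbc|ltcb|] := ltngtP b c; last by [].
    have [ltac|ltca|/val_inj eqac] := ltngtP a c.
    + have := t_le b a c; lia.
    + have := t_le b c a; lia.
    + by rewrite eqac; lia.
  have ltca := ltn_trans ltcb ltba; rewrite [a < c]ltnNge (ltnW ltca) ltca /=.
  by have := t_le c b a; lia.
- by move=> a b; rewrite -val_eqE !inE /=; case: ltngtP => //= _ _; case: leqP.
Qed.

Lemma threshold_nat_surj m t : threshold_array m.+1 t ->
  exists P : profile m.+1,
    [/\ narcissistic P, single_crossing (nat_order m.+1) P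
      & forall a b, a < b < m.+1 -> threshold_nat P a b = t a b].
Proof.
move=> t_arr; have [t_bd _] := t_arr.
pose P : profile m.+1 :=
  [ffun i : 'I_m.+1 => LinOrder (order_at_strict_linear i t_arr)].
have PE i a b : before (P i) a b =
    if a < b then i <= t a b else (b < a) && (t b a < i).
  by rewrite /before ffunE inE.
exists P; split.
- apply/narcissisticP => i a; rewrite PE -val_eqE /=.
  have := t_bd i a; have := t_bd a i; have := ltn_ord i; have := ltn_ord a.
  by case: (ltngtP i a) => //=; lia.
- apply/single_crossingP => a b i j k _; rewrite !PE.
  by case: (ltngtP a b) => //=; lia.
move=> a b ltab; rewrite /threshold_nat /threshold.
have [lta ltb] : a < m.+1 /\ b < m.+1 by lia.
under eq_bigl => i do rewrite PE !inordK //.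
have -> : a < b by lia.
(* The value t(a,b) is itself a voter, so the maximum reaches it. *)
have lttm : t a b < m.+1 by have := t_bd a b ltab; lia.
apply/eqP; rewrite eqn_leq; apply/andP; split; first exact/bigmax_leqP.
rewrite -[X in X <= _]/(nat_of_ord (Ordinal lttm)); exact: leq_bigmax_cond.
Qed.

(** * Counting profiles by patterns *)

Theorem theorem3 (n : nat) (hn : 2 <= n) :
  #|[set P : profile n | narcissistic P && single_crossing (nat_order n) P]|
  = 2 ^ 'C(n.-1, 2).
Proof.
case: n hn => // m _ /=; rewrite -size_gt_patterns_even.
set S := [set P | _].
have SP P : P \in S -> narcissistic P /\ single_crossing (nat_order m.+1) P.
  by rewrite inE => /andP.
rewrite cardE -(size_map (fun P => pattern_of m (threshold_nat P))).
apply/perm_size/uniq_perm.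
- rewrite map_inj_in_uniq ?enum_uniq // => P Q.
  rewrite !mem_enum => /SP[narP scP] /SP[narQ scQ] eqPQ.
  apply: threshold_nat_inj => //.
  by apply: pattern_of_inj eqPQ _ _; apply: threshold_nat_array.
- exact: gt_patterns_uniq.
move=> p; apply/mapP/idP => [[P]|/mem_gt_patterns_pattern_of[t t_arr <-]].
  by rewrite mem_enum => /SP[narP scP] ->; apply/pattern_of_mem/threshold_nat_array.
have [P [narP scP Pt]] := threshold_nat_surj t_arr.
exists P; first by rewrite mem_enum inE narP.
(* [pattern_of] reads its array only at pairs a < b < m + 1, where [Pt] applies. *)
apply/eq_in_map => d; rewrite mem_iota => ltd.
by apply/eq_in_map => j; rewrite mem_iota => ltj; rewrite Pt //; lia.
Qed.
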